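(* Consider any sequence of positive numbers $\{\xi_n\}_{n=1}^{\infty}$ such that $\xi_n\to 0$ and $\sqrt{n}\xi_n\to\infty$ as $n\to\infty$. When the rate $R^\mathrm{i}$ approaches capacity $C_{\rm{bio}}$ from above, the probability of correct decoding scales as \begin{align} \lim_{n\to\infty} -\frac{\log \mathrm{P}_\mathrm{c}^*(n,C_{\rm{bio}}+\xi_n)}{n\xi_n^2}=\frac{1}{2\mathrm{V}}. \end{align} Similarly, when the rate $R^\mathrm{i}$ approaches capacity $C_{\rm{bio}}$ from below, the probability of correct decoding scales as \begin{align} \lim_{n\to\infty} -\frac{\log (1-\mathrm{P}_\mathrm{c}^*(n,C_{\rm{bio}}-\xi_n))}{n\xi_n^2}=\frac{1}{2\mathrm{V}}. \end{align}
   Context: Biometrical identification problem: $\mathcal{X},\mathcal{Y},\mathcal{Z}$ are finite alphabets; $M$ feature vectors $X^n(1),\ldots,X^n(M)$ are generated i.i.d. according to $P_X^n$; for each $m$, $Y^n(m)$ is the output of a DMC $P_{Y|X}$ with input $X^n(m)$ and is stored without compression. An index $W$ uniform on $\{1,\ldots,M\}$, independent of everything else, is drawn; the user observes $Z^n$, the output of a DMC $P_{Z|X}$ with input $X^n(W)$, and outputs $\hat{W}=g^{(n)}(Y^n(1),\ldots,Y^n(M),Z^n)$ for a deterministic decoding function $g^{(n)}$. The probability of correct decoding is $\mathrm{P}_\mathrm{c}^{(n)}(g^{(n)})=\Pr\{\hat{W}=W\}$. Let $\mathrm{P}_\mathrm{c}^*(n,R^\mathrm{i})$ be the maximum probability of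 correct decoding (over decoders) when the number of items $M$ satisfies $\log M\ge nR^\mathrm{i}$. Let $(Y,Z)\sim P_{YZ}$ induced by $P_X\times P_{Y|X}\times P_{Z|X}$; the capacity is $C_{\mathrm{bio}}=I(P_Y,P_{Z|Y})$, and $\mathrm{V}:=\mathrm{Var}\left[\log\frac{P_{Z|Y}(Z|Y)}{P_Z(Z)}\right]$ is assumed to satisfy $\mathrm{V}>0$. *)

(* Defs.v *)
From HB Require Import structures.
From mathcomp Require Import all_boot all_order all_algebra.
From mathcomp Require Import all_classical all_reals all_analysis.
Set Implicit Arguments. Unset Strict Implicit. Unset Printing Implicit Defensive.
Import Order.TTheory GRing.Theory Num.Theory.
Local Open Scope ring_scope.

Section Bio.
Variables (R : realType) (X Y Z : finType).

Definition is_dist (T : finType) (P : T -> R) :=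
  (forall t, 0 <= P t) /\ \sum_(t : T) P t = 1.

Definition is_channel (A B : finType) (W : A -> B -> R) :=
  forall a, is_dist (W a).

Variables (PX : X -> R) (PYX : X -> Y -> R) (PZX : X -> Z -> R).

Definition PXn n (x : {ffun 'I_n -> X}) : R := \prod_(i < n) PX (x i).
Definition Wn (A B : finType) (W : A -> B -> R) n
  (a : {ffun 'I_n -> A}) (b : {ffun 'I_n -> B}) : R := \prod_(i < n) W (a i) (b i).

(* Probability of correct decoding Pr{ g(Y^n(1..M), Z^n) = W } for
   M items, W uniform on the M indices. *)
Definition Pc n M
  (g : {ffun 'I_M -> {ffun 'I_n -> Y}} -> {ffun 'I_n -> Z} -> 'I_M) : R :=
  \sum_(w : 'I_M)
   \sum_(xs : {ffun 'I_M -> {ffun 'I_n -> X}})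
    \sum_(ys : {ffun 'I_M -> {ffun 'I_n -> Y}})
     \sum_(z : {ffun 'I_n -> Z})
       (M%:R)^-1 *
       (\prod_(m < M) (PXn (xs m) * Wn PYX (xs m) (ys m))) *
       Wn PZX (xs w) z *
       (if g ys z == w then 1 else 0).

Definition Pcstar n (Ri : R) : R :=
  sup [set p | exists M : nat, exists g, (0 < M)%N /\ n%:R * Ri <= ln M%:R /\
               p = @Pc n M g].

Definition PYZ y z : R := \sum_(x : X) PX x * PYX x y * PZX x z.
Definition PY y : R := \sum_(z : Z) PYZ y z.
Definition PZ z : R := \sum_(y : Y) PYZ y z.
Definition PZgY z y : R := PYZ y z / PY y.

Definition infdens y z : R := ln (PZgY z y / PZ z).

(* C_bio = I(P_Y, P_{Z|Y}) = E[infdens(Y,Z)] (convention 0 log 0 = 0) *)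
Definition Cbio : R :=
  \sum_(y : Y) \sum_(z : Z | 0 < PYZ y z) PYZ y z * infdens y z.

Definition Vdisp : R :=
  \sum_(y : Y) \sum_(z : Z | 0 < PYZ y z) PYZ y z * (infdens y z - Cbio) ^+ 2.

End Bio.

(* Main.v *)
(** The index [W] is decoded from the random codebook [Y^n(1), ..., Y^n(M)], known to
    the decoder. A decoder that succeeds must either see an information density
    above [th], or guess, so [Pc <= P(i > th) + e^th / M]; conversely, decoding to
    the codeword whose density exceeds [th] gives [Pc >= P(i > th) (1 - M e^(-th))].
    With [th = n (C + c xi_n)] and [c] close to [1] or [-1], on the proper side, the terms
    [e^(th - n Ri)] and [e^(n Ri - th)] are [exp(- d n xi_n)], negligible with respect
    to [exp(- K n xi_n^2)], and only the moderate deviations of the i.i.d. sum of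
    information densities remain. These follow from
    [log E exp(t xi_n (i - C)) ~ V t^2 xi_n^2 / 2] by Chernoff's bound and
    exponential tilting. *)

Require Import Defs.
From HB Require Import structures.
From mathcomp Require Import all_boot all_order all_algebra ring lra.
From mathcomp Require Import all_classical all_reals all_analysis.
Set Implicit Arguments. Unset Strict Implicit. Unset Printing Implicit Defensive.
Import Order.TTheory GRing.Theory Num.Theory.
Import numFieldNormedType.Exports.
Local Open Scope classical_set_scope.
Local Open Scope ring_scope.

(** * Moment generating functions and Gaussian tails *)

(** From [expR (- c) >= 1 - c] follows [expR c * (1 - c) <= 1], and [(1 + c + 2 * c ^+ 2) * (1 - c)]
    is at least [1] as soon as [c <= 1/2]. *)
Lemma expR_sub1_bound (R : realType) (c : R) : `|c| <= 2^-1 ->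
  0 <= expR c - 1 - c <= 2 * c ^+ 2.
Proof.
rewrite ler_norml => /andP[cl cu].
have e1 := expR_ge1Dx c.
have e2 : expR c * (1 - c) <= 1.
  rewrite -[leRHS](expRxMexpNx_1 c) ler_wpM2l ?expR_ge0//; exact: expR_ge1Dx.
have e3 : expR c * (1 - c) <= (1 + c + 2 * c ^+ 2) * (1 - c).
  apply: le_trans e2 _.
  have -> : (1 + c + 2 * c ^+ 2) * (1 - c) = 1 + c ^+ 2 * (1 - 2 * c) by ring.
  rewrite lerDl mulr_ge0 ?sqr_ge0//; lra.
rewrite ler_pM2r in e3; last lra.
by apply/andP; split; lra.
Qed.

(** Mean value theorem on the remainder [f], whose derivative [expR y - 1 - y] is quadratically
    small by [expR_sub1_bound]. *)
Lemma expR_taylor2 (R : realType) (x : R) : `|x| <= 2^-1 ->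
  `|expR x - 1 - x - x ^+ 2 / 2| <= 2 * `|x| ^+ 3.
Proof.
move=> x_le.
pose f (y : R) := expR y - 1 - y - y ^+ 2 / 2.
pose df (y : R) := expR y - 1 - y.
have fD (y : R) : is_derive y 1 f (df y).
  apply: is_derive_eq.
  by rewrite /df /GRing.scale /=; lra.
have fC : continuous f.
  by move=> y; apply: differentiable_continuous; apply/derivable1_diffP; apply: ex_derive.
have f0 : f 0 = 0 by rewrite /f expR0; lra.
have df_le (c : R) : `|c| <= `|x| -> `|df c| <= 2 * `|x| ^+ 2.
  move=> cx; have /andP[d0 d1] := expR_sub1_bound (le_trans cx x_le).
  rewrite ger0_norm//; apply: le_trans d1 _.
  by rewrite ler_pM2l// -(real_normK (num_real c)) lerXn2r// nnegrE.
rewrite -/(f x).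
have [x0|x0] := leP 0 x.
  have [c cI] := @MVT_segment R f df 0 x x0 (fun y _ => fD y) (continuous_subspaceT fC).
  rewrite f0 !subr0 => ->; rewrite normrM exprSr mulrA ler_wpM2r//.
  apply: df_le; move: cI; rewrite in_itv/= => /andP[c0 cx].
  by rewrite !ger0_norm.
have [c cI] := @MVT_segment R f df x 0 (ltW x0) (fun y _ => fD y) (continuous_subspaceT fC).
rewrite f0 !sub0r => /(congr1 -%R); rewrite opprK => ->.
rewrite normrN normrM normrN exprSr mulrA ler_wpM2r//.
apply: df_le; move: cI; rewrite in_itv/= => /andP[c0 cx].
by rewrite !ler0_norm ?lerN2// ltW.
Qed.

Lemma expR_le_quad (R : realType) (y : R) : `|y| <= 2^-1 ->
  expR y <= 1 + y + 2 * y ^+ 2.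
Proof. by move=> /expR_sub1_bound /andP[_]; lra. Qed.

Section MomentGenerating.
Variables (R : realType) (T : finType) (P : T -> R) (h : T -> R) (V : R).
Hypotheses (P_dist : is_dist P) (h_mean : \sum_t P t * h t = 0).
Hypothesis h_var : \sum_t P t * h t ^+ 2 = V.
Variable xi : nat -> R.
Hypotheses (xi_gt0 : forall n, 0 < xi n) (xi_cvg : xi n @[n --> \oo] --> 0).

Lemma near_small (a e : R) : 0 <= a -> 0 < e -> \forall n \near \oo, a * xi n <= e.
Proof.
move=> a0 e0.
have ea : 0 < e / (a + 1) by rewrite divr_gt0//; lra.
have := xi_cvg; move/cvgr0_norm_le => /(_ _ ea); apply: filterS => n.
rewrite (gtr0_norm (xi_gt0 n)) ler_pdivlMr; last lra.
have := xi_gt0 n; nra.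
Qed.

(** Taylor expansion under the sum: the zero mean removes the linear term and the variance gives the
    quadratic one. The sum of all [|h t|] serves as a crude uniform bound on [h]. *)
Lemma mgf_cubic_error : exists2 B : R, 0 <= B & forall x : R, B * `|x| <= 2^-1 ->
  `|\sum_t P t * expR (x * h t) - 1 - x ^+ 2 * V / 2| <= 2 * (B * `|x|) ^+ 3.
Proof.
have [P0 P1] := P_dist.
exists (\sum_t `|h t|) => [|x xB]; first exact: sumr_ge0.
set B := \sum_t _ in xB *.
have hB t : `|h t| <= B by rewrite /B (bigD1 t)//= lerDl sumr_ge0.
have -> : \sum_t P t * expR (x * h t) - 1 - x ^+ 2 * V / 2 =
    \sum_t P t * (expR (x * h t) - 1 - x * h t - (x * h t) ^+ 2 / 2).
  have -> : x ^+ 2 * V / 2 = \sum_t (P t * h t ^+ 2) * (x ^+ 2 / 2).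
    by rewrite -mulr_suml h_var; lra.
  have e1 : \sum_t (P t * h t) * x = 0 by rewrite -mulr_suml h_mean mul0r.
  rewrite [RHS](eq_bigr (fun t => P t * expR (x * h t) - P t - P t * h t * x -
    P t * h t ^+ 2 * (x ^+ 2 / 2))) => [|t _]; last by field.
  by rewrite !sumrB P1 e1 subr0.
apply: le_trans (ler_norm_sum _ _ _) _.
rewrite -[leRHS]mul1r -[X in _ <= X * _]P1 mulr_suml; apply: ler_sum => t _.
rewrite normrM (ger0_norm (P0 t)) ler_wpM2l//.
have xh : `|x * h t| <= B * `|x|.
  by rewrite normrM mulrC ler_wpM2r.
apply: le_trans (expR_taylor2 (le_trans xh xB)) _.
by rewrite ler_pM2l// lerXn2r ?nnegrE// (le_trans _ xh).
Qed.

(** At the point [t * xi n] the cubic error is [xi n ^+ 2] times a multiple of [xi n], hence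
    absorbed by [eps]. Passing from [1 + y] to [expR y] uses [1 + y <= expR y] for the upper bound
    and [expR_le_quad] for the lower one. *)
Lemma mgf_asymptotics (t eps : R) : 0 < eps -> \forall n \near \oo,
  expR (xi n ^+ 2 * (V * t ^+ 2 / 2 - eps)) <= \sum_x P x * expR (t * xi n * h x)
  <= expR (xi n ^+ 2 * (V * t ^+ 2 / 2 + eps)).
Proof.
move=> eps0; have [B B0 HB] := mgf_cubic_error.
pose b := V * t ^+ 2 / 2 - eps.
pose K := 2 * (B * `|t|) ^+ 3.
have K0 : 0 <= K by rewrite mulr_ge0// exprn_ge0// mulr_ge0.
have Bt0 : 0 <= B * `|t| by rewrite mulr_ge0.
have h0 : 0 < 2^-1 :> R by rewrite invr_gt0.
have e20 : 0 < eps / 2 by rewrite divr_gt0.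
have n1 := near_small Bt0 h0.
have n2 := near_small K0 e20.
have n3 := near_small (normr_ge0 b) h0.
have n4 := near_small ler01 h0.
have bb0 : 0 <= 2 * b ^+ 2 by rewrite mulr_ge0// sqr_ge0.
have n5 := near_small bb0 e20.
near=> n.
have x0 := xi_gt0 n.
have i1 : B * `|t| * xi n <= 2^-1 by near: n.
have i2 : K * xi n <= eps / 2 by near: n.
have i3 : `|b| * xi n <= 2^-1 by near: n.
have i4 : 1 * xi n <= 2^-1 by near: n.
have i5 : 2 * b ^+ 2 * xi n <= eps / 2 by near: n.
have nx : B * `|t * xi n| = B * `|t| * xi n by rewrite normrM (gtr0_norm x0) mulrA.
have := HB (t * xi n); rewrite nx => /(_ i1).
set m := \sum_x _ => {}HB.
have {}HB : `|m - 1 - (t * xi n) ^+ 2 * V / 2| <= xi n ^+ 2 * (eps / 2).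
  apply: le_trans HB _.
  have -> : 2 * (B * `|t| * xi n) ^+ 3 = xi n ^+ 2 * (K * xi n) by rewrite /K; ring.
  by rewrite ler_pM2l// exprn_gt0.
move: HB; rewrite ler_norml exprMn => /andP[HB1 HB2].
set q := xi n ^+ 2 in HB1 HB2 *.
have q0 : 0 < q by rewrite exprn_gt0.
apply/andP; split; last first.
  apply: le_trans (expR_ge1Dx _); nra.
have yb : `|q * b| <= 2^-1.
  rewrite normrM (gtr0_norm q0) /q expr2 -mulrA (mulrC _ `|b|).
  have := normr_ge0 b; nra.
apply: le_trans (expR_le_quad yb) _.
have : 2 * (q * b) ^+ 2 <= q * (eps / 2).
  have -> : 2 * (q * b) ^+ 2 = q * ((2 * b ^+ 2 * xi n) * xi n) by rewrite /q; ring.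
  rewrite ler_pM2l//; nra.
rewrite /b; nra.
Unshelve. all: by end_near.
Qed.

End MomentGenerating.

(** * Gaussian tails from a quadratic log moment generating function *)

Section GaussianTails.
Variables (R : realType) (Om : nat -> finType) (w S : forall n, Om n -> R).
Variables (u : nat -> R) (V : R).
Arguments w : clear implicits.
Arguments S : clear implicits.
Hypotheses (w_ge0 : forall n o, 0 <= w n o) (V_gt0 : 0 < V).
Hypothesis u_cvg : u n @[n --> \oo] --> +oo.
(** A condition of Gärtner-Ellis type with speed [u] and limit [V * t ^+ 2 / 2]. Stated for abstract
    [S], it serves both the centred sum and its opposite. *)
Hypothesis mgf : forall t eps : R, 0 < eps -> \forall n \near \oo,
  expR (u n * (V * t ^+ 2 / 2 - eps)) <= \sum_o w n o * expR (t * S n o)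
  <= expR (u n * (V * t ^+ 2 / 2 + eps)).

Lemma chernoff_upper n (t c : R) : 0 <= t ->
  \sum_(o | c <= S n o) w n o <= expR (- (t * c)) * \sum_o w n o * expR (t * S n o).
Proof.
move=> t0; rewrite mulr_sumr big_mkcond; apply: ler_sum => o _.
have e0 := expR_ge0; case: ifP => [cS|_]; last by rewrite !mulr_ge0.
rewrite mulrCA -expRD ler_peMr//.
have := expR_ge1Dx (- (t * c) + t * S n o); have := ler_wpM2l t0 cS; lra.
Qed.

(** Chernoff's bound at [t = c / V], the minimiser of [V * t ^+ 2 / 2 - t * c]. *)
Lemma gaussian_tail_le (c eps : R) : 0 <= c -> 0 < eps -> \forall n \near \oo,
  \sum_(o | c * u n <= S n o) w n o <= expR (- (u n * (c ^+ 2 / (2 * V) - eps))).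
Proof.
move=> c0 eps0; have t0 : 0 <= c / V by rewrite divr_ge0// ltW.
have := mgf (c / V) eps0; apply: filterS => n /andP[_ mU].
apply: le_trans (@chernoff_upper n (c / V) _ t0) _.
apply: le_trans (ler_wpM2l (expR_ge0 _) mU) _.
rewrite -expRD ler_expR le_eqVlt; apply/orP; left; apply/eqP.
by field; rewrite gt_eqF.
Qed.

Lemma near_expRN_le (a e : R) : 0 < a -> 0 < e -> \forall n \near \oo, expR (- (a * u n)) <= e.
Proof.
move=> a0 e0; have /cvgryPge := u_cvg => /(_ (e^-1 / a)); apply: filterS => n.
rewrite ler_pdivrMr// => H; rewrite expRN invf_ple ?posrE ?expR_gt0//.
have := expR_ge1Dx (a * u n); lra.
Qed.

(* Tilting by [expR (l * S)] with [l = a / V] concentrates [S] around [a * u n]: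
   both sides of the window [(a - b, a + b)] are exponentially negligible by Chernoff. *)
Lemma gaussian_window_ge (a b : R) : 0 <= a -> 0 < b -> \forall n \near \oo,
  expR (- (u n * (a ^+ 2 / (2 * V) + a * b / V + b ^+ 2 / (8 * V)))) / 2 <=
  \sum_(o | (a - b) * u n < S n o) w n o.
Proof.
move=> a0 b0.
(* Shifting the tilt by [s] gains [b ^+ 2 / (2 * V) = 4 * d] in the exponent. The two mgf estimates
   cost [d] each, and the remaining [2 * d] makes each outer piece at most [lhs / 4]. *)
pose d := b ^+ 2 / (8 * V).
have d0 : 0 < d by rewrite divr_gt0 ?exprn_gt0 ?mulr_gt0.
pose l := a / V; pose s := b / V.
have s0 : 0 <= s by rewrite divr_ge0// ltW.
have l0 : 0 <= l by rewrite divr_ge0// ltW.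
have m1 := mgf l d0; have m2 := mgf (l - s) d0; have m3 := mgf (l + s) d0.
have d20 : 0 < 2 * d by rewrite mulr_gt0.
have q0 : 0 < 4^-1 :> R by rewrite invr_gt0.
have e1 := near_expRN_le d20 q0.
near=> n.
have /andP[mL _] : expR (u n * (V * l ^+ 2 / 2 - d)) <= \sum_o w n o * expR (l * S n o)
  <= expR (u n * (V * l ^+ 2 / 2 + d)) by near: n.
have /andP[_ mM] : expR (u n * (V * (l - s) ^+ 2 / 2 - d)) <= \sum_o w n o * expR ((l - s) * S n o)
  <= expR (u n * (V * (l - s) ^+ 2 / 2 + d)) by near: n.
have /andP[_ mP] : expR (u n * (V * (l + s) ^+ 2 / 2 - d)) <= \sum_o w n o * expR ((l + s) * S n o)
  <= expR (u n * (V * (l + s) ^+ 2 / 2 + d)) by near: n.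
have small : expR (- (2 * d * u n)) <= 4^-1 by near: n.
set lhs := expR (u n * (V * l ^+ 2 / 2 - d)) in mL.
have ge0e := @expR_ge0 R.
(* Pointwise in [o]: the first term dominates left of the window, the second right of it, and inside
   it [l * S n o <= l * ((a + b) * u n)] gives the third. *)
have dec : \sum_o w n o * expR (l * S n o) <=
    expR (s * ((a - b) * u n)) * (\sum_o w n o * expR ((l - s) * S n o)) +
    expR (- (s * ((a + b) * u n))) * (\sum_o w n o * expR ((l + s) * S n o)) +
    expR (l * ((a + b) * u n)) * \sum_(o | (a - b) * u n < S n o) w n o.
  rewrite !mulr_sumr [X in _ <= _ + X]big_mkcond -!big_split; apply: ler_sum => o _ /=.
  have w0 := w_ge0 o.
  have A1 : 0 <= expR (s * ((a - b) * u n)) * (w n o * expR ((l - s) * S n o)).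
    by rewrite !mulr_ge0.
  have A2 : 0 <= expR (- (s * ((a + b) * u n))) * (w n o * expR ((l + s) * S n o)).
    by rewrite !mulr_ge0.
  case: ifPn => [S1|]; last first.
    rewrite -leNgt => S1; rewrite addr0 -[leLHS]addr0 lerD// mulrCA -expRD.
    rewrite ler_wpM2l// ler_expR; have := ler_wpM2l s0 S1; lra.
  have [S2|S2] := leP (S n o) ((a + b) * u n).
    rewrite -[leLHS]add0r lerD ?addr_ge0// mulrC ler_wpM2r// ler_expR ler_wpM2l//.
  rewrite -[leLHS]addr0 lerD ?mulr_ge0// -[leLHS]add0r lerD// mulrCA -expRD.
  rewrite ler_wpM2l// ler_expR; have := ler_wpM2l s0 (ltW S2); lra.
have Vn0 : V != 0 by rewrite gt_eqF.
have T1 : expR (s * ((a - b) * u n)) * (\sum_o w n o * expR ((l - s) * S n o)) <= lhs / 4.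
  apply: le_trans (ler_wpM2l (ge0e _) mM) _; rewrite -expRD.
  apply: le_trans (ler_wpM2l (ge0e _) small); rewrite /lhs -expRD ler_expR.
  by rewrite le_eqVlt; apply/orP; left; apply/eqP; rewrite /l /s /d; field.
have T2 : expR (- (s * ((a + b) * u n))) * (\sum_o w n o * expR ((l + s) * S n o)) <= lhs / 4.
  apply: le_trans (ler_wpM2l (ge0e _) mP) _; rewrite -expRD.
  apply: le_trans (ler_wpM2l (ge0e _) small); rewrite /lhs -expRD ler_expR.
  by rewrite le_eqVlt; apply/orP; left; apply/eqP; rewrite /l /s /d; field.
set p := \sum_(o | _) w n o in dec *.
have E : lhs / 2 <= expR (l * ((a + b) * u n)) * p by lra.
rewrite -(ler_pM2l (expR_gt0 (l * ((a + b) * u n)))) (mulrA (expR _)) -expRD.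
apply: le_trans E; rewrite ler_pM2r ?invr_gt0// ler_expR.
by rewrite le_eqVlt; apply/orP; left; apply/eqP; rewrite /l /s /d; field.
Unshelve. all: by end_near.
Qed.

Lemma gaussian_tail_ge (c eps : R) : 0 <= c -> 0 < eps -> \forall n \near \oo,
  expR (- (u n * (c ^+ 2 / (2 * V) + eps))) <= \sum_(o | c * u n < S n o) w n o.
Proof.
move=> c0 eps0.
(* The window is centred at [c + b], so that its left end is [c]. Its extra cost
   [(2 * c * b + 13 / 8 * b ^+ 2) / V] is at most [2 * b * (c + 1) / V <= eps / 2]; the other
   [eps / 2] absorbs the factor [1 / 2]. *)
pose b := Num.min 1 (eps * V / (4 * (c + 1))).
have c1 : 0 < 4 * (c + 1) by lra.
have b0 : 0 < b by rewrite lt_min ltr01 divr_gt0// mulr_gt0.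
have b1 : b <= 1 by rewrite ge_min lexx.
have bV : b * (4 * (c + 1)) <= eps * V.
  by rewrite -ler_pdivlMr// ge_min lexx orbT.
have cb0 : 0 <= c + b by lra.
have e0 : 0 < eps / 2 by lra.
have h0 : 0 < 2^-1 :> R by lra.
have := gaussian_window_ge cb0 b0; have := near_expRN_le e0 h0.
have /cvgryPge := u_cvg => /(_ 0); apply: filterS3 => n u0 sm.
rewrite addrK; apply: le_trans.
apply: (@le_trans _ _ (expR (- (u n * (c ^+ 2 / (2 * V) + eps / 2))) / 2)).
  apply: le_trans (ler_wpM2l (expR_ge0 _) sm); rewrite -expRD ler_expR; lra.
rewrite ler_pM2r ?invr_gt0// ler_expR lerN2 ler_wpM2l//.
have Vn0 : V != 0 by rewrite gt_eqF.
have -> : (c + b) ^+ 2 / (2 * V) + (c + b) * b / V + b ^+ 2 / (8 * V) =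
   c ^+ 2 / (2 * V) + (2 * c * b + 13 / 8 * b ^+ 2) / V by field.
rewrite lerD2l ler_pdivrMr//; nra.
Qed.

End GaussianTails.

(** * Threshold decoding of a random code *)

Section RandomCode.
Variables (R : realType) (A B : finType) (p : A -> B -> R).
Hypotheses (p_ge0 : forall a b, 0 <= p a b) (p_sum : \sum_a \sum_b p a b = 1).

Definition margl a : R := \sum_b p a b.
Definition margr b : R := \sum_a p a b.

(** The information density exceeds [ln c], in a multiplicative form that stays meaningful when a
    marginal vanishes. *)
Definition dense (c : R) a b := c * (margl a * margr b) < p a b.
Definition dense_prob (c : R) : R := \sum_a \sum_(b | dense c a b) p a b.

(* Success probability over [M] independent codewords drawn from [margl], the
   received word being jointly distributed with the [w]-th codeword. *)
Definition code_success M (g : {ffun 'I_M -> A} -> B -> 'I_M) : R :=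
  \sum_(w : 'I_M) \sum_(ys : {ffun 'I_M -> A}) \sum_z
    M%:R^-1 * (\prod_(m < M) (if m == w then p (ys m) z else margl (ys m))) *
    (if g ys z == w then 1 else 0).

Lemma margl_ge0 a : 0 <= margl a. Proof. exact: sumr_ge0. Qed.

Lemma margr_ge0 b : 0 <= margr b. Proof. exact: sumr_ge0. Qed.

Lemma margl_sum : \sum_a margl a = 1. Proof. by []. Qed.

Lemma margr_sum : \sum_b margr b = 1. Proof. by rewrite exchange_big. Qed.

Lemma le_margr a b : p a b <= margr b.
Proof. by rewrite /margr (bigD1 a)//= lerDl sumr_ge0. Qed.

Lemma dense_prob_ge0 c : 0 <= dense_prob c.
Proof. by apply: sumr_ge0 => a _; apply: sumr_ge0. Qed.

Lemma dense_prob_compl c :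
  \sum_a \sum_(b | ~~ dense c a b) p a b = 1 - dense_prob c.
Proof.
rewrite -p_sum /dense_prob -sumrB; apply: eq_bigr => a _.
by rewrite [in RHS](bigID (dense c a) xpredT)/= [RHS]addrC addKr.
Qed.

Lemma dense_prob_le1 c : dense_prob c <= 1.
Proof.
by rewrite -subr_ge0 -dense_prob_compl; apply: sumr_ge0 => a _; apply: sumr_ge0.
Qed.

Lemma sum_codebooks M (w : 'I_M) (f h : A -> R) :
  \sum_(ys : {ffun 'I_M -> A}) \prod_(m < M) (if m == w then f (ys m) else h (ys m)) =
  (\sum_a f a) * (\sum_a h a) ^+ M.-1.
Proof.
rewrite -(bigA_distr_bigA (fun m a => if m == w then f a else h a)) (bigD1 w)//= eqxx.
congr (_ * _); rewrite (eq_bigr (fun=> \sum_a h a)) => [|m /negbTE ->//].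
by rewrite prodr_const cardC1 card_ord.
Qed.

Lemma prod_codeword M (w : 'I_M) (f h : A -> R) (ys : {ffun 'I_M -> A}) :
  \prod_(m < M) (if m == w then f (ys m) else h (ys m)) =
  f (ys w) * \prod_(m < M | m != w) h (ys m).
Proof.
by rewrite (bigD1 w)//= eqxx; congr (_ * _); apply: eq_bigr => m /negbTE ->.
Qed.

Lemma sum_uniform M (x : R) : (0 < M)%N -> \sum_(w < M) M%:R^-1 * x = x.
Proof.
move=> M0; rewrite sumr_const card_ord -[LHS]mulr_natl mulrA divff ?mul1r//.
by rewrite pnatr_eq0 -lt0n.
Qed.

(** Dense pairs are granted as successes. On the others [p] is at most [c] times the product of the
    marginals, under which the received word is independent of the codebook and every decoder
    succeeds with probability [1 / M]. *)
Lemma code_success_le M (g : {ffun 'I_M -> A} -> B -> 'I_M) (c : R) :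
  (0 < M)%N -> 0 <= c -> code_success g <= dense_prob c + c / M%:R.
Proof.
move=> M0 c0.
have Mi0 : 0 <= M%:R^-1 :> R by rewrite invr_ge0.
pose q a b := if dense c a b then p a b else 0.
have q0 a b : 0 <= q a b by rewrite /q; case: ifP.
have -> : dense_prob c = \sum_(w < M) \sum_(ys : {ffun 'I_M -> A}) \sum_z
    M%:R^-1 * \prod_(m < M) (if m == w then q (ys m) z else margl (ys m)).
  rewrite -[LHS](sum_uniform _ M0); apply: eq_bigr => w _.
  rewrite exchange_big /=.
  under [RHS]eq_bigr => z _ do
    rewrite -mulr_sumr (sum_codebooks w (q^~ z) margl) margl_sum expr1n mulr1.
  rewrite -mulr_sumr exchange_big /dense_prob; congr (_ * _).
  by apply: eq_bigr => a _; rewrite big_mkcond.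
have -> : c / M%:R = \sum_(w < M) \sum_(ys : {ffun 'I_M -> A}) \sum_z
    M%:R^-1 * (c * margr z * \prod_(m < M) margl (ys m)) *
    (if g ys z == w then 1 else 0).
  transitivity (\sum_(ys : {ffun 'I_M -> A}) \sum_z
      M%:R^-1 * c * (\prod_(m < M) margl (ys m)) * margr z).
    under eq_bigr => ys _ do rewrite -mulr_sumr margr_sum mulr1.
    rewrite -mulr_sumr -(bigA_distr_bigA (fun m : 'I_M => margl)) big1 ?mulr1 1?mulrC//.
  rewrite [RHS]exchange_big /=; apply: eq_bigr => ys _.
  rewrite [RHS]exchange_big /=; apply: eq_bigr => z _.
  (* For given [ys] and [z] exactly one index [w] is the decoded one. *)
  rewrite -mulr_sumr [X in _ = _ * X](bigD1 (g ys z))//= eqxx [X in _ * (_ + X)]big1 => [|w]; first by ring.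
  by rewrite eq_sym => /negbTE ->.
rewrite /code_success -big_split; apply: ler_sum => w _.
rewrite -big_split; apply: ler_sum => ys _.
rewrite -big_split; apply: ler_sum => z _ /=.
rewrite (prod_codeword w (p^~ z) margl) (prod_codeword w (q^~ z) margl) -!mulrA -mulrDr ler_wpM2l//.
rewrite [X in _ * (_ * (X * _))](bigD1 w)//=.
set r := \prod_(m < M | _) _.
have r0 : 0 <= r by apply: prodr_ge0 => m _; exact: margl_ge0.
have l0 := margl_ge0 (ys w); have m0 := margr_ge0 z.
case: ifP => _; last by rewrite !mulr0 addr0 mulr_ge0.
rewrite !mulr1 /q; case: ifPn => [_|]; first by rewrite lerDl !mulr_ge0.
rewrite /dense -leNgt mul0r add0r => H.
rewrite [leRHS](_ : _ = c * (margl (ys w) * margr z) * r); last by ring.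
exact: ler_wpM2r.
Qed.

Lemma bernoulli_sub (x : R) k : 0 <= x <= 1 -> 1 - k%:R * x <= (1 - x) ^+ k.
Proof.
move=> /andP[x0 x1]; elim: k => [|k IH]; first by rewrite mul0r subr0 expr0.
have := ler_wpM2l (_ : 0 <= 1 - x) IH; rewrite exprS -natr1.
have : 0 <= k%:R * x ^+ 2 by rewrite mulr_ge0 ?sqr_ge0//.
move=> k0 /(_ ltac:(lra)); apply: le_trans; lra.
Qed.

(** Change of measure: summing [c * margl a * margr z < p a z] over the dense [a] gives at most
    [margr z]. If [margr z] is zero, so is [p a z], and no [a] is dense. *)
Lemma dense_margl_le c z : 0 < c -> \sum_(a | dense c a z) margl a <= c^-1.
Proof.
move=> c0; have [mz|] := ltP 0 (margr z); last first.
  move=> mz; rewrite big1 ?invr_ge0 ?ltW// => a; rewrite /dense => H.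
  have pz : p a z <= 0 by exact: le_trans (le_margr a z) mz.
  have : 0 <= c * (margl a * margr z).
    by rewrite !mulr_ge0 ?margl_ge0 ?margr_ge0// ltW.
  by move=> H2; have := lt_le_trans (le_lt_trans H2 H) pz; rewrite ltxx.
rewrite -(ler_pM2r mz) -(ler_pM2l c0) (mulrA c c^-1) divff ?gt_eqF// mul1r.
rewrite mulr_suml mulr_sumr; apply: (@le_trans _ _ (\sum_(a | dense c a z) p a z)).
  by apply: ler_sum => a; rewrite /dense => /ltW.
by rewrite [leRHS](bigID (fun a => dense c a z))/= lerDl sumr_ge0.
Qed.

(** Only the event that the true codeword is the unique dense one is counted. Each independent
    competitor is dense with probability at most [1 / c], and Bernoulli's inequality handles the
    product over competitors. *)
Lemma exists_code M c : (0 < M)%N -> 1 <= c ->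
  exists g : {ffun 'I_M -> A} -> B -> 'I_M,
    dense_prob c * (1 - M%:R / c) <= code_success g.
Proof.
case: M => // M _ c1.
have c0 : 0 < c by lra.
pose g (ys : {ffun 'I_M.+1 -> A}) z :=
  if [pick m | dense c (ys m) z] is Some m then m else ord0.
exists g.
pose q a b := if dense c a b then p a b else 0.
(* [q] keeps the dense true codeword, [r] the competitors that are not dense; the sum of their
   products is the probability of the counted event. *)
pose r b a := if dense c a b then 0 else margl a.
have q0 a b : 0 <= q a b by rewrite /q; case: ifP.
have r0 a b : 0 <= r b a by rewrite /r; case: ifP => // _; exact: margl_ge0.
have rS z : \sum_a r z a = 1 - \sum_(a | dense c a z) margl a.
  rewrite -margl_sum [in RHS](bigID (fun a => dense c a z) xpredT)/= [RHS]addrC addKr.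
  by rewrite [RHS]big_mkcond; apply: eq_bigr => a _; rewrite /r; case: ifP.
have dz z : 0 <= \sum_(a | dense c a z) margl a <= 1.
  rewrite sumr_ge0 => [|a _]; last exact: margl_ge0.
  by apply: le_trans (dense_margl_le z c0) _; rewrite invf_le1.
apply: (@le_trans _ _ (\sum_(w < M.+1) \sum_(ys : {ffun 'I_M.+1 -> A}) \sum_z
    M.+1%:R^-1 * \prod_(m < M.+1) (if m == w then q (ys m) z else r z (ys m)))).
  rewrite -[leLHS](sum_uniform _ (ltn0Sn M)); apply: ler_sum => w _.
  rewrite [leRHS]exchange_big /=.
  under [leRHS]eq_bigr => z _ do rewrite -mulr_sumr (sum_codebooks w (q^~ z) (r z)).
  rewrite -mulr_sumr ler_wpM2l ?invr_ge0// /dense_prob.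
  under eq_bigr => a _ do rewrite big_mkcond.
  rewrite exchange_big mulr_suml; apply: ler_sum => z _.
  apply: ler_wpM2l; first by apply: sumr_ge0 => a _; exact: (q0 a z).
  rewrite /= rS; apply: le_trans (bernoulli_sub M (dz z)); rewrite lerD2l lerN2.
  apply: ler_pM => //; [by case/andP: (dz z)|by rewrite ler_nat|exact: dense_margl_le].
apply: ler_sum => w _; apply: ler_sum => ys _; apply: ler_sum => z _.
rewrite (prod_codeword w (q^~ z) (r z)) (prod_codeword w (p^~ z) margl).
rewrite -mulrA ler_wpM2l ?invr_ge0//.
have R0 : 0 <= p (ys w) z * \prod_(m < M.+1 | m != w) margl (ys m).
  by rewrite mulr_ge0// prodr_ge0// => m _; exact: margl_ge0.
have [allN|] := boolP [forall m, (m != w) ==> ~~ dense c (ys m) z]; last first.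
  rewrite negb_forall => /existsP[m]; rewrite negb_imply negbK => /andP[mw dm].
  rewrite [X in _ * X](bigD1 m)//= /r dm mul0r mulr0 mulr_ge0//; by case: ifP.
have [dw|ndw] := boolP (dense c (ys w) z); last first.
  rewrite /q (negbTE ndw) mul0r mulr_ge0//; by case: ifP.
have -> : g ys z == w.
  rewrite /g; case: pickP => [m dm|/(_ w)]; last by rewrite dw.
  by apply: contraTT dm => mw; have /forallP/(_ m)/implyP/(_ mw) := allN.
rewrite mulr1 /q dw ler_wpM2l// ler_prod// => m mw; rewrite r0/= /r.
by case: ifP => // _; exact: margl_ge0.
Qed.

End RandomCode.

(** * Reduction of the identification problem to the random code *)

Section Identification.
Variables (R : realType) (X Y Z : finType).
Variables (PX : X -> R) (PYX : X -> Y -> R) (PZX : X -> Z -> R).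
Hypotheses (hPX : is_dist PX) (hPYX : is_channel PYX) (hPZX : is_channel PZX).

Definition PYZn n (y : {ffun 'I_n -> Y}) (z : {ffun 'I_n -> Z}) : R :=
  \prod_(i < n) PYZ PX PYX PZX (y i) (z i).

Lemma PYZ_ge0 y z : 0 <= PYZ PX PYX PZX y z.
Proof.
apply: sumr_ge0 => x _; have [PX0 _] := hPX.
by rewrite !mulr_ge0//; [have [] := hPYX x|have [] := hPZX x].
Qed.

Lemma PY_channel y : PY PX PYX PZX y = \sum_x PX x * PYX x y.
Proof.
rewrite /PY /PYZ exchange_big; apply: eq_bigr => x _.
by rewrite -mulr_sumr (hPZX x).2 mulr1.
Qed.

Lemma PYZ_sum : \sum_y \sum_z PYZ PX PYX PZX y z = 1.
Proof.
rewrite (eq_bigr (PY PX PYX PZX))//; under eq_bigr => y _ do rewrite PY_channel.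
rewrite exchange_big -hPX.2; apply: eq_bigr => x _.
by rewrite -mulr_sumr (hPYX x).2 mulr1.
Qed.

Lemma sum_prod_pair n (f : Y -> Z -> R) :
  \sum_(y : {ffun 'I_n -> Y}) \sum_(z : {ffun 'I_n -> Z}) \prod_(i < n) f (y i) (z i)
  = (\sum_y \sum_z f y z) ^+ n.
Proof.
under eq_bigr => y _ do rewrite -(bigA_distr_bigA (fun i => f (y i))).
by rewrite -(bigA_distr_bigA (fun _ y => \sum_z f y z)) prodr_const card_ord.
Qed.

Lemma PYZn_ge0 n y z : 0 <= @PYZn n y z.
Proof. by apply: prodr_ge0 => i _; exact: PYZ_ge0. Qed.

Lemma PYZn_sum n : \sum_y \sum_z @PYZn n y z = 1.
Proof. by rewrite sum_prod_pair PYZ_sum expr1n. Qed.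

Lemma margl_PYZn n y : margl (@PYZn n) y = \prod_(i < n) PY PX PYX PZX (y i).
Proof. by rewrite (bigA_distr_bigA (fun i => PYZ PX PYX PZX (y i))). Qed.

Lemma margr_PYZn n z : margr (@PYZn n) z = \prod_(i < n) PZ PX PYX PZX (z i).
Proof. by rewrite (bigA_distr_bigA (fun i => (PYZ PX PYX PZX)^~ (z i))). Qed.

(** The feature vectors are summed out item by item: item [w] leaves the joint law of its stored
    vector and the observation, every other item the marginal law of its stored vector. *)
Lemma Pc_code_success n M (g : {ffun 'I_M -> {ffun 'I_n -> Y}} -> {ffun 'I_n -> Z} -> 'I_M) :
  Pc PX PYX PZX g = code_success (@PYZn n) g.
Proof.
apply: eq_bigr => w _; rewrite exchange_big /=; apply: eq_bigr => ys _.
rewrite exchange_big /=; apply: eq_bigr => z _.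
rewrite -mulr_suml; congr (_ * _).
under [LHS]eq_bigr => xs _ do rewrite -mulrA.
rewrite -mulr_sumr; congr (_ * _).
pose F (m : 'I_M) (x : {ffun 'I_n -> X}) := PXn PX x * Wn PYX x (ys m) *
  (if m == w then Wn PZX x z else 1).
transitivity (\sum_(xs : {ffun 'I_M -> {ffun 'I_n -> X}}) \prod_(m < M) F m (xs m)).
  apply: eq_bigr => xs _; rewrite [RHS]big_split/=; congr (_ * _).
  by rewrite -big_mkcond/= big_pred1_eq.
rewrite -(bigA_distr_bigA F); apply: eq_bigr => m _; rewrite /F.
case: eqVneq => _.
  pose f i x := PX x * PYX x (ys m i) * PZX x (z i).
  rewrite /PYZn /PYZ (bigA_distr_bigA f); apply: eq_bigr => x _.
  by rewrite /PXn /Wn -!big_split.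
rewrite margl_PYZn; under [RHS]eq_bigr => i _ do rewrite PY_channel.
pose f i x := PX x * PYX x (ys m i).
rewrite (bigA_distr_bigA f); apply: eq_bigr => x _.
by rewrite mulr1 /PXn /Wn -!big_split.
Qed.

Lemma Pcstar_le n (Ri c : R) : 0 <= c ->
  Pcstar PX PYX PZX n Ri <= dense_prob (@PYZn n) c + c * expR (- (n%:R * Ri)).
Proof.
move=> c0; rewrite /Pcstar; set E := [set _ | _].
have d0 := dense_prob_ge0 (@PYZn_ge0 n) c.
(* The supremum of the empty set is [0], which is below the nonnegative bound. *)
have [E0|/set0P E0] := eqVneq E set0.
  by rewrite E0 sup0 addr_ge0// mulr_ge0// expR_ge0.
apply: ge_sup => // x [M [g [M0 [nR ->]]]].
rewrite Pc_code_success; apply: le_trans (code_success_le (@PYZn_ge0 n) (PYZn_sum n) g M0 c0) _.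
rewrite lerD2l ler_wpM2l// expRN lef_pV2 ?posrE ?expR_gt0 ?ltr0n//.
by rewrite -[leRHS]lnK ?posrE ?ltr0n// ler_expR.
Qed.

Lemma Pcstar_ge n (Ri c : R) : 0 <= n%:R * Ri -> 1 <= c ->
  dense_prob (@PYZn n) c * (1 - 2 * expR (n%:R * Ri) / c) <= Pcstar PX PYX PZX n Ri.
Proof.
move=> nR c1.
have e1 : 1 <= expR (n%:R * Ri) by rewrite -[leLHS](expR0 R) ler_expR.
(* Rounding up meets the rate constraint, and costs at most a factor [2] because
   [expR (n%:R * Ri) >= 1]. *)
pose M := (Num.trunc (expR (n%:R * Ri))).+1.
have Me : expR (n%:R * Ri) <= M%:R by rewrite ltW// truncnS_gt.
have M2 : M%:R <= 2 * expR (n%:R * Ri).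
  have : (Num.trunc (expR (n%:R * Ri)))%:R <= expR (n%:R * Ri).
    by rewrite truncn_le expR_ge0.
  by rewrite /M -natr1; lra.
have [g Hg] := exists_code (@PYZn_ge0 n) (PYZn_sum n) (ltn0Sn _ : 0 < M)%N c1.
apply: (@le_trans _ _ (Pc PX PYX PZX g)).
  rewrite Pc_code_success; apply: le_trans Hg.
  apply: ler_wpM2l; first exact: (dense_prob_ge0 (@PYZn_ge0 n)).
  by rewrite lerD2l lerN2 ler_wpM2r// invr_ge0; lra.
apply: ub_le_sup.
  (* The converse at [c = 1] gives the crude bound [1 + 1 / M' <= 2], enough for the supremum to be
     an upper bound. *)
  exists 2 => x [M' [g' [M'0 [nR' ->]]]].
  rewrite Pc_code_success.
  apply: le_trans (code_success_le (@PYZn_ge0 n) (PYZn_sum n) g' M'0 ler01) _.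
  rewrite (_ : 2 = 1 + 1)// lerD//.
    exact: (dense_prob_le1 (@PYZn_ge0 n) (PYZn_sum n)).
  by rewrite mul1r invf_le1 ?ler1n ?ltr0n.
exists M, g; split=> //; split=> //.
by rewrite -[leLHS](expRK) ler_ln ?posrE ?expR_gt0 ?ltr0n.
Qed.

End Identification.

(** * Moderate deviations of the information density *)

(** The lower exponential bound also makes [q n] positive eventually, so [ln (q n)] is a genuine
    logarithm. *)
Lemma cvg_log_scale (R : realType) (u q : nat -> R) (L : R) :
  u n @[n --> \oo] --> +oo ->
  (forall eps, 0 < eps -> \forall n \near \oo,
    expR (- (u n * (L + eps))) <= q n <= expR (- (u n * (L - eps)))) ->
  - ln (q n) / u n @[n --> \oo] --> L.
Proof.
move=> u_cvg H; apply/cvgrPdist_le => eps eps0.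
have /cvgryPge := u_cvg => /(_ 1); have := H _ eps0; apply: filterS2 => n /andP[qL qU] u1.
have u0 : 0 < u n by lra.
have q0 : 0 < q n by apply: lt_le_trans qL; exact: expR_gt0.
have lL : - (u n * (L + eps)) <= ln (q n) by rewrite -[leLHS]expRK ler_ln ?posrE ?expR_gt0.
have lU : ln (q n) <= - (u n * (L - eps)) by rewrite -[leRHS]expRK ler_ln ?posrE ?expR_gt0.
rewrite distrC ler_distl; apply/andP; split.
  by rewrite ler_pdivlMr//; lra.
by rewrite ler_pdivrMr//; lra.
Qed.

Section ModerateDeviations.
Variables (R : realType) (X Y Z : finType).
Variables (PX : X -> R) (PYX : X -> Y -> R) (PZX : X -> Z -> R).
Hypotheses (hPX : is_dist PX) (hPYX : is_channel PYX) (hPZX : is_channel PZX).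
Local Notation p := (PYZ PX PYX PZX).
Local Notation inf := (infdens PX PYX PZX).
Local Notation C := (Cbio PX PYX PZX).
Local Notation V := (Vdisp PX PYX PZX).
Local Notation pn := (@PYZn R X Y Z PX PYX PZX _).
Local Notation law n := (@PYZn R X Y Z PX PYX PZX n).
Let p0 := PYZ_ge0 hPX hPYX hPZX.

Definition centered (t : Y * Z) : R := inf t.1 t.2 - C.

Lemma sum_PYZ_support (f : Y -> Z -> R) :
  \sum_y \sum_(z | 0 < p y z) p y z * f y z = \sum_(t : Y * Z) p t.1 t.2 * f t.1 t.2.
Proof.
rewrite -(pair_bigA _ (fun y z => p y z * f y z)); apply: eq_bigr => y _.
rewrite big_mkcond; apply: eq_bigr => z _.
by case: (ltgtP 0 (p y z)) (p0 y z) => // <-; rewrite mul0r.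
Qed.

Lemma PYZ_pair_dist : is_dist (fun t : Y * Z => p t.1 t.2).
Proof. by split=> //; rewrite -(pair_bigA _ p) (PYZ_sum hPX hPYX hPZX). Qed.

Lemma centered_mean : \sum_t p t.1 t.2 * centered t = 0.
Proof.
under eq_bigr => t _ do rewrite mulrBr.
by rewrite sumrB -sum_PYZ_support -mulr_suml PYZ_pair_dist.2 mul1r subrr.
Qed.

Lemma centered_var : \sum_t p t.1 t.2 * centered t ^+ 2 = V.
Proof. by rewrite -(sum_PYZ_support (fun y z => (inf y z - C) ^+ 2)). Qed.

Lemma PY_ge_PYZ y z : p y z <= PY PX PYX PZX y.
Proof. by rewrite /PY (bigD1 z)//= lerDl sumr_ge0. Qed.

Lemma PZ_ge_PYZ y z : p y z <= PZ PX PYX PZX z.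
Proof. by rewrite /PZ (bigD1 y)//= lerDl sumr_ge0. Qed.

Lemma PYZ_infdens y z : 0 < p y z ->
  p y z = expR (inf y z) * (PY PX PYX PZX y * PZ PX PYX PZX z).
Proof.
move=> pp.
have y0 : 0 < PY PX PYX PZX y by exact: lt_le_trans pp (PY_ge_PYZ _ _).
have z0 : 0 < PZ PX PYX PZX z by exact: lt_le_trans pp (PZ_ge_PYZ _ _).
rewrite /infdens lnK ?posrE ?divr_gt0// /PZgY.
by field; rewrite !gt_eqF.
Qed.

(* Equality in [E exp(-inf) <= 1] would force [inf] to vanish on the support. *)
Lemma Cbio_gt0 : 0 < V -> 0 < C.
Proof.
move=> V0; rewrite ltNge; apply/negP => C0.
(* This sum equals [E exp(-inf) - 1 + C], while its terms are nonnegative; hence all of them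
   vanish. *)
have H1 : \sum_(t : Y * Z) p t.1 t.2 * (expR (- inf t.1 t.2) - 1 + inf t.1 t.2) <= 0.
  have E1 : \sum_(t : Y * Z) p t.1 t.2 * expR (- inf t.1 t.2) <= 1.
    apply: (@le_trans _ _ (\sum_(t : Y * Z) PY PX PYX PZX t.1 * PZ PX PYX PZX t.2)).
      apply: ler_sum => t _.
      have [t0|] := ltP 0 (p t.1 t.2).
        by rewrite [X in X * _](PYZ_infdens t0) mulrAC expRxMexpNx_1 mul1r.
      move=> tn; have -> : p t.1 t.2 = 0 by apply/le_anti; rewrite tn p0.
      by rewrite mul0r mulr_ge0//; apply: sumr_ge0.
    rewrite -(pair_bigA _ (fun y z => PY PX PYX PZX y * PZ PX PYX PZX z)).
    under eq_bigr => y _ do rewrite -mulr_sumr.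
    rewrite -mulr_suml (PYZ_sum hPX hPYX hPZX : \sum_y PY PX PYX PZX y = 1) mul1r.
    by rewrite exchange_big (PYZ_sum hPX hPYX hPZX).
  have -> : \sum_(t : Y * Z) p t.1 t.2 * (expR (- inf t.1 t.2) - 1 + inf t.1 t.2) =
      \sum_(t : Y * Z) p t.1 t.2 * expR (- inf t.1 t.2) - 1 + C.
    rewrite [in RHS]/Cbio sum_PYZ_support -[X in _ - X + _]PYZ_pair_dist.2 -sumrB -big_split.
    by apply: eq_bigr => t _ /=; ring.
  lra.
have nn (t : Y * Z) : true -> 0 <= p t.1 t.2 * (expR (- inf t.1 t.2) - 1 + inf t.1 t.2).
  by move=> _; rewrite mulr_ge0//; have := expR_ge1Dx (- inf t.1 t.2); lra.
have S0 : \sum_(t : Y * Z) p t.1 t.2 * (expR (- inf t.1 t.2) - 1 + inf t.1 t.2) == 0.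
  by rewrite eq_le H1 sumr_ge0.
move: S0; rewrite psumr_eq0// => /allP Hz.
have inf0 (t : Y * Z) : p t.1 t.2 * inf t.1 t.2 = 0.
  have := Hz t (mem_index_enum t); rewrite implyTb mulf_eq0 => /orP[/eqP->|/eqP e].
    by rewrite mul0r.
  have [->|i0] := eqVneq (inf t.1 t.2) 0; first by rewrite mulr0.
  by have := @expR_gt1Dx _ (- inf t.1 t.2); rewrite oppr_eq0 => /(_ i0); lra.
have C00 : C = 0 by rewrite /Cbio sum_PYZ_support big1.
move: V0; rewrite -centered_var big1 ?ltxx// => t _.
by rewrite /centered C00 subr0 expr2 mulrA inf0 mul0r.
Qed.

Lemma PYZn_infdens n (y : {ffun 'I_n -> Y}) (z : {ffun 'I_n -> Z}) : 0 < pn y z ->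
  pn y z = expR (\sum_(i < n) inf (y i) (z i)) * (margl pn y * margr pn z).
Proof.
move=> pp; rewrite margl_PYZn margr_PYZn.
rewrite expR_sum -!big_split; apply: eq_bigr => i _ /=; apply: PYZ_infdens.
rewrite lt_neqAle p0 andbT eq_sym; apply: contraTneq pp => i0.
by rewrite /PYZn (bigD1 i)//= i0 mul0r ltxx.
Qed.

Lemma dense_infdens n (y : {ffun 'I_n -> Y}) (z : {ffun 'I_n -> Z}) (th : R) : 0 < pn y z ->
  dense pn (expR th) y z = (th < \sum_(i < n) inf (y i) (z i)).
Proof.
move=> pp; have e := PYZn_infdens pp; rewrite /dense [X in _ < X]e.
rewrite ltr_pM2r ?ltr_expR//; rewrite e pmulr_rgt0 ?expR_gt0// in pp.
Qed.

Variable xi : nat -> R.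
Hypotheses (xi_gt0 : forall n, 0 < xi n) (xi_cvg : xi n @[n --> \oo] --> 0).
Hypothesis xi_inf : (Num.sqrt n%:R * xi n) @[n --> \oo] --> +oo.
Hypothesis V_gt0 : 0 < V.

Definition speed n : R := n%:R * xi n ^+ 2.

(** The factor [xi n] turns a deviation [c * n * xi n] of the sum into the level [c * speed n], and
    a fixed tilt [t] into the tilt [t * xi n] per letter. *)
Definition scaled_sum n (o : {ffun 'I_n -> Y} * {ffun 'I_n -> Z}) : R :=
  xi n * \sum_(i < n) centered (o.1 i, o.2 i).

Lemma speed_cvg : speed n @[n --> \oo] --> +oo.
Proof.
apply/cvgryPge => A; have /cvgryPge := xi_inf => /(_ (`|A| + 1)); apply: filterS => n H.
have -> : speed n = (Num.sqrt n%:R * xi n) ^+ 2 by rewrite exprMn sqr_sqrtr.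
have := ler_norm A; have := normr_ge0 A; rewrite expr2; nra.
Qed.

Lemma speed_ge0 n : 0 <= speed n.
Proof. by rewrite mulr_ge0// sqr_ge0. Qed.

Lemma mgf_scaled_sum n (t : R) :
  \sum_(o : {ffun 'I_n -> Y} * {ffun 'I_n -> Z}) pn o.1 o.2 * expR (t * scaled_sum o) =
  (\sum_x p x.1 x.2 * expR (t * xi n * centered x)) ^+ n.
Proof.
rewrite -(pair_bigA _ (fun y z => p y z * expR (t * xi n * centered (y, z)))) /=.
rewrite -sum_prod_pair.
rewrite (pair_bigA _ (fun (y : {ffun 'I_n -> Y}) (z : {ffun 'I_n -> Z}) =>
  \prod_(i < n) (p (y i) (z i) * expR (t * xi n * centered (y i, z i))))).
apply: eq_bigr => o _; rewrite big_split /=; congr (_ * _).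
by rewrite -expR_sum /scaled_sum mulrA mulr_sumr.
Qed.

Lemma mgf_scaled_asymptotics (t eps : R) : 0 < eps -> \forall n \near \oo,
  expR (speed n * (V * t ^+ 2 / 2 - eps)) <=
  \sum_(o : {ffun 'I_n -> Y} * {ffun 'I_n -> Z}) pn o.1 o.2 * expR (t * scaled_sum o)
  <= expR (speed n * (V * t ^+ 2 / 2 + eps)).
Proof.
move=> eps0.
have := mgf_asymptotics PYZ_pair_dist centered_mean centered_var xi_gt0 xi_cvg t eps0.
apply: filterS => n /andP[mL mU]; rewrite mgf_scaled_sum /speed -!(mulrA n%:R) !expRM_natl.
have m0 : 0 <= \sum_x p x.1 x.2 * expR (t * xi n * centered x).
  by apply: sumr_ge0 => x _; rewrite mulr_ge0 ?expR_ge0.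
by apply/andP; split; rewrite lerXn2r ?nnegrE ?expR_ge0//.
Qed.

Lemma mgf_opp_scaled_asymptotics (t eps : R) : 0 < eps -> \forall n \near \oo,
  expR (speed n * (V * t ^+ 2 / 2 - eps)) <=
  \sum_(o : {ffun 'I_n -> Y} * {ffun 'I_n -> Z}) pn o.1 o.2 * expR (t * - scaled_sum o)
  <= expR (speed n * (V * t ^+ 2 / 2 + eps)).
Proof.
move=> eps0; have := mgf_scaled_asymptotics (- t) eps0; apply: filterS => n.
by rewrite sqrrN; under eq_bigr => o _ do rewrite mulNr -mulrN.
Qed.

Definition threshold n (c : R) : R := expR (n%:R * (C + c * xi n)).

Lemma dense_prob_tail n (c : R) : dense_prob (law n) (threshold n c) =
  \sum_(o : {ffun 'I_n -> Y} * {ffun 'I_n -> Z} | c * speed n < scaled_sum o) pn o.1 o.2.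
Proof.
rewrite /dense_prob pair_big_dep /= big_mkcond [RHS]big_mkcond.
apply: eq_bigr => o _.
have := PYZn_ge0 hPX hPYX hPZX o.1 o.2; rewrite le_eqVlt => /orP[/eqP<-|pp].
  by rewrite !if_same.
congr (if _ then _ else _); rewrite dense_infdens// /scaled_sum /speed.
rewrite /centered sumrB sumr_const card_ord -[C *+ n]mulr_natl.
rewrite (_ : c * (n%:R * _) = xi n * (n%:R * (c * xi n))); last by ring.
by rewrite ltr_pM2l// ltrBrDl mulrDr.
Qed.

Lemma dense_prob_tail_compl n (c : R) : 1 - dense_prob (law n) (threshold n (- c)) =
  \sum_(o : {ffun 'I_n -> Y} * {ffun 'I_n -> Z} | c * speed n <= - scaled_sum o) pn o.1 o.2.
Proof.
rewrite dense_prob_tail.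
have <- : \sum_(o : {ffun 'I_n -> Y} * {ffun 'I_n -> Z}) pn o.1 o.2 = 1.
  by rewrite -(PYZn_sum hPX hPYX hPZX n) pair_bigA.
rewrite [in LHS](bigID (fun o => - c * speed n < scaled_sum o) xpredT)/= [LHS]addrC addKr.
by apply: eq_bigl => o; rewrite -leNgt lerNr mulNr.
Qed.

Let pn_ge0 n (o : {ffun 'I_n -> Y} * {ffun 'I_n -> Z}) := PYZn_ge0 hPX hPYX hPZX o.1 o.2.

Lemma upper_tail_le (c eps : R) : 0 <= c -> 0 < eps -> \forall n \near \oo,
  dense_prob (law n) (threshold n c) <= expR (- (speed n * (c ^+ 2 / (2 * V) - eps))).
Proof.
move=> c0 e0.
have := gaussian_tail_le pn_ge0 V_gt0 mgf_scaled_asymptotics c0 e0.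
apply: filterS => n; apply: le_trans; rewrite dense_prob_tail.
rewrite big_mkcond [leRHS]big_mkcond; apply: ler_sum => o _.
by case: ltP => [/ltW ->//|_]; case: ifP.
Qed.

Lemma upper_tail_ge (c eps : R) : 0 <= c -> 0 < eps -> \forall n \near \oo,
  expR (- (speed n * (c ^+ 2 / (2 * V) + eps))) <= dense_prob (law n) (threshold n c).
Proof.
move=> c0 e0.
have := gaussian_tail_ge pn_ge0 V_gt0 speed_cvg mgf_scaled_asymptotics c0 e0.
by apply: filterS => n; rewrite dense_prob_tail.
Qed.

Lemma lower_tail_le (c eps : R) : 0 <= c -> 0 < eps -> \forall n \near \oo,
  1 - dense_prob (law n) (threshold n (- c)) <= expR (- (speed n * (c ^+ 2 / (2 * V) - eps))).
Proof.
move=> c0 e0.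
have := gaussian_tail_le pn_ge0 V_gt0 mgf_opp_scaled_asymptotics c0 e0.
by apply: filterS => n; rewrite dense_prob_tail_compl.
Qed.

Lemma lower_tail_ge (c eps : R) : 0 <= c -> 0 < eps -> \forall n \near \oo,
  expR (- (speed n * (c ^+ 2 / (2 * V) + eps))) <= 1 - dense_prob (law n) (threshold n (- c)).
Proof.
move=> c0 e0.
have := gaussian_tail_ge pn_ge0 V_gt0 speed_cvg mgf_opp_scaled_asymptotics c0 e0.
apply: filterS => n; rewrite dense_prob_tail_compl => /le_trans; apply.
rewrite big_mkcond [leRHS]big_mkcond; apply: ler_sum => o _.
by case: ltP => [/ltW ->//|_]; case: ifP.
Qed.

(** [speed n] is [xi n] times [n%:R * xi n], and [xi n] tends to zero. *)
Lemma linear_dominates (K d : R) : 0 <= K -> 0 < d -> \forall n \near \oo,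
  expR (- (d * (n%:R * xi n))) <= expR (- (speed n * K)).
Proof.
move=> K0 d0; have := near_small xi_gt0 xi_cvg K0 d0; apply: filterS => n H.
rewrite ler_expR lerN2 /speed (_ : _ * K = (K * xi n) * (n%:R * xi n)); last by ring.
by rewrite ler_wpM2r// mulr_ge0// ltW.
Qed.

Lemma near_quarter (a : R) : 0 < a -> \forall n \near \oo, expR (- (a * speed n)) <= 4^-1.
Proof. by move=> a0; apply: near_expRN_le => //; exact: speed_cvg. Qed.

(** * Exponents on both sides of capacity *)

Let L := (2 * V)^-1.
Let L_gt0 : 0 < L. Proof. by rewrite invr_gt0 mulr_gt0. Qed.

(** [d] offsets the decoding threshold from the rate. As [d <= 1/2], replacing [L] by
    [(1 + d) ^+ 2 * L] or [(1 - d) ^+ 2 * L] changes it by less than [eps / 2]. *)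
Lemma slack_exists (eps : R) : 0 < eps ->
  exists d : R, [/\ 0 < d, d <= 2^-1 & d * L <= eps / 8].
Proof.
move=> eps0; exists (Num.min 2^-1 (eps / 8 / L)); split.
- by rewrite lt_min invr_gt0 ltr0n !divr_gt0.
- by rewrite ge_min lexx.
- by rewrite -ler_pdivlMr// ge_min lexx orbT.
Qed.

(** The converse takes the threshold [1 - d], below the rate, so that guessing contributes only
    [expR (- (d * (n%:R * xi n)))]. Achievability takes [1 + d], above the rate, so that the
    collision factor is at least [1 / 2]. *)
Lemma above_capacity (eps : R) : 0 < eps -> \forall n \near \oo,
  expR (- (speed n * (L + eps))) <= Pcstar PX PYX PZX n (C + xi n)
  <= expR (- (speed n * (L - eps))).
Proof.
move=> eps0; have [d [d0 d1 dL]] := slack_exists eps0.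
have e40 : 0 < eps / 4 by lra.
have cm0 : 0 <= 1 - d by lra.
have cp0 : 0 <= 1 + d by lra.
have n1 := upper_tail_le cm0 e40; have n2 := upper_tail_ge cp0 e40.
have n3 := linear_dominates (ltW L_gt0) d0; have n4 := near_quarter e40.
have n5 := near_quarter L_gt0.
near=> n.
have tU : dense_prob (law n) (threshold n (1 - d)) <=
  expR (- (speed n * ((1 - d) ^+ 2 / (2 * V) - eps / 4))) by near: n.
have tL : expR (- (speed n * ((1 + d) ^+ 2 / (2 * V) + eps / 4))) <=
  dense_prob (law n) (threshold n (1 + d)) by near: n.
have lin : expR (- (d * (n%:R * xi n))) <= expR (- (speed n * L)) by near: n.
have quarter : expR (- (eps / 4 * speed n)) <= 4^-1 by near: n.
have quarterL : expR (- (L * speed n)) <= 4^-1 by near: n.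
have u0 := speed_ge0 n; have x0 := xi_gt0 n; have C0 := Cbio_gt0 V_gt0.
apply/andP; split; last first.
  have := Pcstar_le hPX hPYX hPZX n (C + xi n) (expR_ge0 (n%:R * (C + (1 - d) * xi n))).
  move/le_trans; apply; rewrite -expRD.
  have -> : n%:R * (C + (1 - d) * xi n) + - (n%:R * (C + xi n)) = - (d * (n%:R * xi n)).
    by ring.
  have A1 : dense_prob (law n) (threshold n (1 - d)) <= expR (- (speed n * (L - eps / 2))).
    apply: le_trans tU _; rewrite ler_expR lerN2 ler_wpM2l// -/L; nra.
  have A2 : expR (- (d * (n%:R * xi n))) <= expR (- (speed n * (L - eps / 2))).
    apply: le_trans lin _; rewrite ler_expR lerN2 ler_wpM2l//; lra.
  have A3 : expR (- (speed n * (L - eps / 2))) <= 4^-1 * expR (- (speed n * (L - eps))).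
    apply: le_trans (ler_wpM2r (expR_ge0 _) quarter); rewrite -expRD ler_expR; nra.
  have := expR_ge0 (- (speed n * (L - eps))).
  move: A1; rewrite /threshold; lra.
have nR : 0 <= n%:R * (C + xi n) by rewrite mulr_ge0//; lra.
have th1 : 1 <= threshold n (1 + d).
  rewrite -[leLHS](expR0 R) ler_expR mulr_ge0//.
  have : 0 <= (1 + d) * xi n by rewrite mulr_ge0// ltW.
  lra.
have := Pcstar_ge hPX hPYX hPZX nR th1; apply: le_trans.
have -> : 2 * expR (n%:R * (C + xi n)) / threshold n (1 + d) = 2 * expR (- (d * (n%:R * xi n))).
  by rewrite /threshold -mulrA -expRN -expRD; congr (2 * expR _); ring.
have A0 : 2 * expR (- (d * (n%:R * xi n))) <= 2^-1.
  by have := le_trans lin (_ : _ <= 4^-1); rewrite mulrC => /(_ quarterL); lra.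
have A1 : expR (- (speed n * (L + 3 / 4 * eps))) <= dense_prob (law n) (threshold n (1 + d)).
  apply: le_trans tL; rewrite ler_expR lerN2 ler_wpM2l// -/L; nra.
have A2 : expR (- (speed n * (L + eps))) <= 4^-1 * expR (- (speed n * (L + 3 / 4 * eps))).
  apply: le_trans (ler_wpM2r (expR_ge0 _) quarter); rewrite -expRD ler_expR; nra.
have := expR_ge0 (- (speed n * (L + 3 / 4 * eps))); nra.
Unshelve. all: by end_near.
Qed.

Lemma below_capacity (eps : R) : 0 < eps -> \forall n \near \oo,
  expR (- (speed n * (L + eps))) <= 1 - Pcstar PX PYX PZX n (C - xi n)
  <= expR (- (speed n * (L - eps))).
Proof.
move=> eps0; have [d [d0 d1 dL]] := slack_exists eps0.
have e40 : 0 < eps / 4 by lra.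
have cm0 : 0 <= 1 - d by lra.
have cp0 : 0 <= 1 + d by lra.
have Le0 : 0 <= L + eps by rewrite addr_ge0// ltW.
have C0 := Cbio_gt0 V_gt0.
have n1 := lower_tail_le cm0 e40; have n2 := lower_tail_ge cp0 e40.
(* The guessing term is subtracted from a tail of size [expR (- (speed n * (L + 3 / 4 * eps)))], so
   it must be small at the exponent [L + eps]. *)
have n3 := linear_dominates Le0 d0; have n4 := near_quarter e40.
(* Positivity of [C] keeps the rate [C - xi n] nonnegative eventually, as [Pcstar_ge] requires. *)
have n5 := near_small xi_gt0 xi_cvg ler01 C0.
near=> n.
have tU : 1 - dense_prob (law n) (threshold n (- (1 - d))) <=
  expR (- (speed n * ((1 - d) ^+ 2 / (2 * V) - eps / 4))) by near: n.
have tL : expR (- (speed n * ((1 + d) ^+ 2 / (2 * V) + eps / 4))) <=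
  1 - dense_prob (law n) (threshold n (- (1 + d))) by near: n.
have lin : expR (- (d * (n%:R * xi n))) <= expR (- (speed n * (L + eps))) by near: n.
have quarter : expR (- (eps / 4 * speed n)) <= 4^-1 by near: n.
have xC : 1 * xi n <= C by near: n.
have u0 := speed_ge0 n; have x0 := xi_gt0 n.
apply/andP; split.
  have := Pcstar_le hPX hPYX hPZX n (C - xi n) (expR_ge0 (n%:R * (C + - (1 + d) * xi n))).
  rewrite -expRD.
  have -> : n%:R * (C + - (1 + d) * xi n) + - (n%:R * (C - xi n)) = - (d * (n%:R * xi n)).
    by ring.
  have A1 : expR (- (speed n * (L + 3 / 4 * eps))) <= 1 - dense_prob (law n) (threshold n (- (1 + d))).
    apply: le_trans tL; rewrite ler_expR lerN2 ler_wpM2l// -/L; nra.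
  have A2 : expR (- (speed n * (L + eps))) <= 4^-1 * expR (- (speed n * (L + 3 / 4 * eps))).
    apply: le_trans (ler_wpM2r (expR_ge0 _) quarter); rewrite -expRD ler_expR; nra.
  have := expR_ge0 (- (speed n * (L + 3 / 4 * eps))).
  move: A1; rewrite /threshold; lra.
have nR : 0 <= n%:R * (C - xi n) by rewrite mulr_ge0//; lra.
have th1 : 1 <= threshold n (- (1 - d)).
  rewrite -[leLHS](expR0 R) ler_expR mulr_ge0//.
  have : 0 <= d * xi n by rewrite mulr_ge0// ltW.
  lra.
have := Pcstar_ge hPX hPYX hPZX nR th1.
have -> : 2 * expR (n%:R * (C - xi n)) / threshold n (- (1 - d)) = 2 * expR (- (d * (n%:R * xi n))).
  by rewrite /threshold -mulrA -expRN -expRD; congr (2 * expR _); ring.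
have A1 : 1 - dense_prob (law n) (threshold n (- (1 - d))) <= expR (- (speed n * (L - eps / 2))).
  apply: le_trans tU _; rewrite ler_expR lerN2 ler_wpM2l// -/L; nra.
have A2 : expR (- (d * (n%:R * xi n))) <= expR (- (speed n * (L - eps / 2))).
  apply: le_trans lin _; rewrite ler_expR lerN2 ler_wpM2l//; lra.
have A3 : expR (- (speed n * (L - eps / 2))) <= 4^-1 * expR (- (speed n * (L - eps))).
  apply: le_trans (ler_wpM2r (expR_ge0 _) quarter); rewrite -expRD ler_expR; nra.
(* As [dense_prob] is at most [1], the error is at most the lower tail plus twice the collision
   term: three quarters of the target. *)
have := dense_prob_le1 (@PYZn_ge0 _ _ _ _ _ _ _ hPX hPYX hPZX n) (PYZn_sum hPX hPYX hPZX n) (threshold n (- (1 - d))).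
have := expR_ge0 (- (d * (n%:R * xi n))).
have := expR_ge0 (- (speed n * (L - eps))); nra.
Unshelve. all: by end_near.
Qed.

End ModerateDeviations.

Theorem theorem7 (R : realType) (X Y Z : finType)
  (PX : X -> R) (PYX : X -> Y -> R) (PZX : X -> Z -> R)
  (hPX : is_dist PX) (hPYX : is_channel PYX) (hPZX : is_channel PZX)
  (hV : 0 < Vdisp PX PYX PZX)
  (xi : nat -> R)
  (hxi_pos : forall n, 0 < xi n)
  (hxi0 : xi n @[n --> \oo] --> 0)
  (hxi_inf : (Num.sqrt n%:R * xi n) @[n --> \oo] --> +oo) :
  (- ln (Pcstar PX PYX PZX n (Cbio PX PYX PZX + xi n)) / (n%:R * xi n ^+ 2))
     @[n --> \oo] --> (2 * Vdisp PX PYX PZX)^-1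
  /\
  (- ln (1 - Pcstar PX PYX PZX n (Cbio PX PYX PZX - xi n)) / (n%:R * xi n ^+ 2))
     @[n --> \oo] --> (2 * Vdisp PX PYX PZX)^-1.
Proof.
split; apply: cvg_log_scale (speed_cvg hxi_inf) _ => eps eps0.
  exact: above_capacity.
exact: below_capacity.
Qed.
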